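(* Let $A_1,\dots,A_N$ be events in a finite probability space $(\Omega,\mathscr{F},P)$, where $N$ is a fixed positive integer, and let $\boldsymbol{c}=(c_1,\dots,c_N)^T\in\mathbb{R}^N_+$. Define $\tilde\gamma_i:=\sum_k c_kP(A_i\cap A_k)$, $\tilde\alpha_i:=P(A_i)$, and $$\tilde\delta:=\max_i\left[\frac{\tilde\gamma_i-\left(\sum_k c_k-\min_k c_k\right)\tilde\alpha_i}{\min_k c_k}\right]^+ .$$ Then a lower bound on the union probability is given by $$P\left(\bigcup_{i=1}^N A_i\right)\ \ge\ \tilde\delta+\sum_{i=1}^N\ell_i'(\boldsymbol{c},\tilde\delta)=:\ell_{\textrm{NEW-II}}(\boldsymbol{c}),$$ where $$\ell_i'(\boldsymbol{c},x)=\left[P(A_i)-x\right]\left(\frac{c_i}{\sum_{k\in B_1^{(i)}}c_k}+\frac{c_i}{\sum_{k\in B_2^{(i)}}c_k}-\frac{c_i\sum_k c_k\left[P(A_i\cap A_k)-x\right]}{\left[P(A_i)-x\right]\left(\sum_{k\in B_1^{(i)}}c_k\right)\left(\sum_{k\in B_2^{(i)}}c_k\right)}\right)$$ and $$B_1^{(i)}=\arg\max_{\{B\in\mathscr{B}^-:\, i\in B\}}\frac{\sum_{k\in B}c_k}{c_i}\quad\text{s.t.}\quad\frac{\sum_{k\in B}c_k}{c_i}\le\frac{\sum_k c_k\left[P(A_i\cap A_k)-x\right]}{c_i\left[P(A_i)-x\right]},$$ $$B_2^{(i)}=\arg\min_{\{B\in\mathscr{B}^-:\, i\in B\}}\frac{\sum_{k\in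 B}c_k}{c_i}\quad\text{s.t.}\quad\frac{\sum_{k\in B}c_k}{c_i}\ge\frac{\sum_k c_k\left[P(A_i\cap A_k)-x\right]}{c_i\left[P(A_i)-x\right]}.$$
   Context: $\mathscr{B}$ is the collection of all non-empty subsets of $\{1,\dots,N\}$, and $\mathscr{B}^-:=\mathscr{B}\setminus\{\{1,\dots,N\}\}$ is the collection of all non-empty proper subsets of $\{1,\dots,N\}$. $\boldsymbol{c}\in\mathbb{R}^N_+$ means $c_k>0$ for all $k$. $[y]^+:=\max(y,0)$. Indices $i,k$ range over $\{1,\dots,N\}$ unless otherwise indicated.
   Formalization: When no non-empty proper subset containing i meets the constraint for B_2^(i) (possible if c_i is the unique minimum, or N=1), B_2^(i) is taken to be {1,…,N}; if none meets that for B_1^(i), it is {i}; and ℓ_i'(c,x) is read as 0 when P(A_i)=x. *)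

(* Defs.v *)
From HB Require Import structures.
From mathcomp Require Import all_boot all_order all_algebra.
From mathcomp Require Import all_classical all_reals all_analysis.

Set Implicit Arguments.
Unset Strict Implicit.
Unset Printing Implicit Defensive.

Import Order.TTheory GRing.Theory Num.Theory.
Local Open Scope ring_scope.

(* The number of events is N = n.+1, so that N is positive; the indices
   1, ..., N are the elements of 'I_n.+1. *)
Section UnionBound.
Context {d : measure_display} {T : measurableType d} {R : realType}.
Context (P : probability T R) {n : nat}.
Implicit Types (A : 'I_n.+1 -> set T) (c : 'I_n.+1 -> R) (x : R).
Implicit Types (i k : 'I_n.+1) (B : {set 'I_n.+1}).

Definition pr (E : set T) : R := fine (P E).

Definition minc c : R := \big[Num.min/c ord0]_k c k.

Definition alpha A i : R := pr (A i).

Definition gamma A c i : R := \sum_k c k * pr (A i `&` A k)%classic.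

(* The terms are nonnegative, so starting the maximum at 0 is harmless. *)
Definition delta A c : R :=
  \big[Num.max/0]_i
    Num.max ((gamma A c i - (\sum_k c k - minc c) * alpha A i) / minc c) 0.

Definition proper_nonempty B : bool :=
  (B != finset.set0) && (B \proper [set: 'I_n.+1]%SET).

Definition weight c i B : R := (\sum_(k in B) c k) / c i.

Definition threshold A c x i : R :=
  (\sum_k c k * (pr (A i `&` A k)%classic - x)) / (c i * (pr (A i) - x)).

(* [arg max_] and [arg min_] return their starting value when no B satisfies
   the constraints, and otherwise some optimal B; ell' depends on B1 and B2
   only through their (unique) optimal weights.  When c > 0, x = delta A c and
   x < P(A_i), the constraints of B1 are satisfiable, but those of B2 may not be
   when i is the only minimizer of c; B2 is then the full index set, that is,
   the minimizer when B ranges over all subsets containing i. *)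
Definition B1 A c x i : {set 'I_n.+1} :=
  [arg max_(B > [set i]%SET | [&& proper_nonempty B, i \in B &
      weight c i B <= threshold A c x i]) weight c i B]%O.

Definition B2 A c x i : {set 'I_n.+1} :=
  [arg min_(B < [set: 'I_n.+1]%SET | [&& proper_nonempty B, i \in B &
      threshold A c x i <= weight c i B]) weight c i B]%O.

(* If P(A_i) = x the leading factor makes this 0, whatever the value of the
   quotients by P(A_i) - x. *)
Definition ell' A c x i : R :=
  let s1 := \sum_(k in B1 A c x i) c k in
  let s2 := \sum_(k in B2 A c x i) c k in
  (pr (A i) - x) *
  (c i / s1 + c i / s2 -
   (c i * \sum_k c k * (pr (A i `&` A k)%classic - x)) /
   ((pr (A i) - x) * s1 * s2)).

Definition ell_NEW_II A c : R :=
  delta A c + \sum_i ell' A c (delta A c) i.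

End UnionBound.

(* Main.v *)
(* Let p B be the probability that the events containing the sample point are
   exactly those with index in B, and w B = \sum_(k in B) c k.  A proper B has
   w B <= w setT - min c, whence delta <= p setT, so that q, obtained from p by
   subtracting delta from p setT, is nonnegative.  Double counting gives
     P(U A_i) - delta = \sum_i \sum_(B | i \in B) (c i / w B) q B,
   and no B containing i has w B strictly between s1 = w B1 and s2 = w B2, so
   that 1 / w B >= 1 / s1 + 1 / s2 - w B / (s1 s2); summing this against q
   yields ell'. *)
Require Import Defs.
From mathcomp Require Import all_boot all_order all_algebra.
From mathcomp Require Import all_classical all_reals all_analysis.
From mathcomp Require Import ring.

Import Order.TTheory GRing.Theory Num.Theory.
Local Open Scope ring_scope.
Local Open Scope classical_set_scope.

(** Meant for [B1] and [B2], whose starting values may violate the constraint [Q]. Once [Q] is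
    inhabited the starting value is irrelevant, so it can be traded for a point of [Q]. *)
Lemma extremum_or_default {T : eqType} {I : finType} (ord : rel T) (i0 : I)
    (Q : pred I) (F : I -> T) :
    reflexive ord -> transitive ord -> total ord ->
  let m := extremum ord i0 Q F in
  (Q m /\ forall j, Q j -> ord (F m) (F j)) \/ (m = i0 /\ Q =1 xpred0).
Proof.
move=> ordxx ord_tr ord_tot m.
case: (pickP Q) => [j Qj|Q0]; last first.
  right; split=> //; rewrite /m /extremum; case: pickP => //= i /andP[].
  by rewrite Q0.
have -> : m = extremum ord j Q F.
  rewrite /m; have := @extremumP _ _ ord j Q F ordxx ord_tr ord_tot Qj.
  rewrite /extremum; case: pickP => //= no_i [i Qi mini].
  have /negP[] := no_i i; rewrite /= Qi /=; apply/forallP => k.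
  by apply/implyP => /mini.
by left; case: (@extremumP _ _ ord j Q F ordxx ord_tr ord_tot Qj).
Qed.

(** The left side is the secant of 1/s through s1 and s2 (the tangent if s1 = s2); the convex
    function 1/s lies above it outside the interval between them. *)
Lemma inv_ge_chord {R : realFieldType} (s1 s2 s : R) :
    0 < s1 -> 0 < s2 -> 0 < s -> 0 <= (s - s1) * (s - s2) ->
  s1^-1 + s2^-1 - s / (s1 * s2) <= s^-1.
Proof.
move=> s1_gt0 s2_gt0 s_gt0 gap; rewrite -subr_ge0.
have -> : s^-1 - (s1^-1 + s2^-1 - s / (s1 * s2)) =
    (s - s1) * (s - s2) / (s * s1 * s2).
  by field; rewrite !gt_eqF.
by rewrite divr_ge0// !mulr_ge0// ltW.
Qed.

Section Weights.
Context {d : measure_display} {T : measurableType d} {R : realType}.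
Context (P : probability T R) {n : nat}.
Context (A : 'I_n.+1 -> set T) (c : 'I_n.+1 -> R).
Hypothesis c_gt0 : forall k, 0 < c k.
Implicit Types (B : {set 'I_n.+1}) (i : 'I_n.+1) (x : R).

Let w B := \sum_(k in B) c k.

Lemma weight_sum_gt0 i B : i \in B -> 0 < w B.
Proof.
move=> iB; rewrite /w (bigD1 i)//= ltr_pwDl//.
by apply: sumr_ge0 => k _; exact: ltW.
Qed.

Lemma weight_sum_le B1 B2 : B1 \subset B2 -> w B1 <= w B2.
Proof.
move=> /fintype.subsetP sB; rewrite /w [leRHS](bigID (mem B1))/=.
rewrite [X in _ <= X + _](eq_bigl (mem B1)) => [|k].
  by rewrite lerDl sumr_ge0// => k _; exact: ltW.
by rewrite /= andb_idl//; exact: sB.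
Qed.

Lemma minc_gt0 : 0 < minc c.
Proof.
by rewrite /minc; elim/big_ind: _ => // y z y0 z0; rewrite lt_min y0 z0.
Qed.

Lemma proper_weight_sum_le B : B != [set: 'I_n.+1]%SET ->
  w B <= \sum_k c k - minc c.
Proof.
rewrite -finset.subTset => /fintype.subsetPn[k _ kB].
have -> : \sum_k c k = w [set: 'I_n.+1]%SET.
  by apply: eq_bigl => j; rewrite finset.in_setT.
rewrite lerBrDr.
have kck : minc c <= c k by rewrite /minc (bigminD1 k)// ge_min lexx.
apply: (le_trans (lerD (lexx _) kck)).
have -> : w B + c k = w (k |: B)%SET by rewrite /w big_setU1//= addrC.
by apply: weight_sum_le; exact: finset.subsetT.
Qed.

Lemma weight_leE i B1 B2 : (weight c i B1 <= weight c i B2) = (w B1 <= w B2).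
Proof. by rewrite /weight ler_pM2r// invr_gt0. Qed.

(** A proper B containing i competes for [B1] or for [B2], according to the side of the threshold on
    which its weight falls. Hence the problem for that side is feasible, and the optimum there
    bounds the weight of B. *)
Lemma B12_gap x i B : i \in B ->
  [/\ i \in B1 P A c x i, i \in B2 P A c x i &
   0 <= (w B - w (B1 P A c x i)) * (w B - w (B2 P A c x i))].
Proof.
move=> iB.
have le_setT B' : weight c i B' <= weight c i [set: 'I_n.+1]%SET.
  by rewrite weight_leE weight_sum_le// finset.subsetT.
have ge_set1 B' : i \in B' -> weight c i [set i]%SET <= weight c i B'.
  by move=> iB'; rewrite weight_leE weight_sum_le// finset.sub1set.
pose Q1 B :=
  [&& proper_nonempty B, i \in B & weight c i B <= threshold P A c x i].
pose Q2 B :=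
  [&& proper_nonempty B, i \in B & threshold P A c x i <= weight c i B].
have h1 : (Q1 (B1 P A c x i) /\
      forall B, Q1 B -> weight c i B <= weight c i (B1 P A c x i)) \/
    (B1 P A c x i = [set i]%SET /\ Q1 =1 xpred0).
  exact: (@extremum_or_default _ _ >=%R _ Q1 (weight c i)
    ge_refl ge_trans ge_total).
have h2 : (Q2 (B2 P A c x i) /\
      forall B, Q2 B -> weight c i (B2 P A c x i) <= weight c i B) \/
    (B2 P A c x i = [set: 'I_n.+1]%SET /\ Q2 =1 xpred0).
  exact: (@extremum_or_default _ _ <=%R _ Q2 (weight c i)
    lexx le_trans le_total).
rewrite {}/Q1 in h1; rewrite {}/Q2 in h2.
move: (threshold _ _ _ _ _) (B1 _ _ _ _ _) (B2 _ _ _ _ _) h1 h2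
  => t C1 C2 h1 h2.
have iC1 : i \in C1.
  by case: h1 => [[/and3P[]]|[-> _]] //; rewrite finset.in_set1.
have iC2 : i \in C2.
  by case: h2 => [[/and3P[]]|[-> _]] //; rewrite finset.in_setT.
(* If both problems are feasible, the threshold separates the optima; otherwise a default occurs,
   the lightest or the heaviest set containing i. *)
have le12 : w C1 <= w C2.
  rewrite -(weight_leE i).
  case: h1 => [[/and3P[_ _ C1t] _]|[-> _]]; last exact: ge_set1.
  case: h2 => [[/and3P[_ _ tC2] _]|[-> _]]; last exact: le_setT.
  exact: le_trans tC2.
split=> //.
have [le1|le2] : w B <= w C1 \/ w C2 <= w B; last 2 first.
- by rewrite mulr_le0// subr_le0// (le_trans le1).
- by rewrite mulr_ge0// subr_ge0// (le_trans le12).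
(* The full set is no candidate, but no set outweighs it. *)
have [->|BT] := eqVneq B [set: 'I_n.+1]%SET.
  by right; rewrite -(weight_leE i).
have pB : proper_nonempty B.
  rewrite /proper_nonempty finset.properT BT andbT.
  by apply/finset.set0Pn; exists i.
rewrite -!(weight_leE i).
have [Bt|/ltW tB] := leP (weight c i B) t; [left|right].
- case: h1 => [[_]|[_ /(_ B)]]; last by rewrite pB iB Bt.
  by apply; rewrite pB iB Bt.
- case: h2 => [[_]|[_ /(_ B)]]; last by rewrite pB iB tB.
  by apply; rewrite pB iB tB.
Qed.

(** Apart from a vanishing leading factor, [ell'] is linear in the two moments of q given by the
    hypotheses, so the chord inequality can be summed against q. *)
Lemma ell'_le (q : {set 'I_n.+1} -> R) x i :
    (forall B, 0 <= q B) ->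
    pr P (A i) - x = \sum_(B : {set 'I_n.+1} | i \in B) q B ->
    \sum_k c k * (pr P (A i `&` A k) - x) =
      \sum_(B : {set 'I_n.+1} | i \in B) w B * q B ->
  ell' P A c x i <= \sum_(B : {set 'I_n.+1} | i \in B) c i / w B * q B.
Proof.
move=> q0 qa qg; rewrite /ell' qg.
have [iC1 iC2 _] := B12_gap x i _ (finset.set11 i).
rewrite -/(w (B1 P A c x i)) -/(w (B2 P A c x i)).
have s1_gt0 := weight_sum_gt0 _ _ iC1; have s2_gt0 := weight_sum_gt0 _ _ iC2.
(* In this case the leading factor makes [ell'] zero, and the right side is nonnegative. *)
have [->|a0] := eqVneq (pr P (A i) - x) 0.
  rewrite mul0r sumr_ge0// => B iB.
  by rewrite mulr_ge0// divr_ge0// ltW// (weight_sum_gt0 _ _ iB).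
set s1 := w (B1 _ _ _ _ _) in s1_gt0 *; set s2 := w (B2 _ _ _ _ _) in s2_gt0 *.
set a := pr P (A i) - x in a0 qa *.
set g := \sum_(B : {set _} | _) w B * q B.
have -> : a * (c i / s1 + c i / s2 - c i * g / (a * s1 * s2)) =
    c i * (s1^-1 + s2^-1) * a - c i / (s1 * s2) * g.
  by field; rewrite a0 !gt_eqF.
rewrite qa mulr_sumr /g [X in _ - X]mulr_sumr -sumrB; apply: ler_sum => B iB.
have [_ _ gap] := B12_gap x i B iB.
have := inv_ge_chord _ _ _ s1_gt0 s2_gt0 (weight_sum_gt0 _ _ iB) gap.
move=> chord; rewrite -subr_ge0.
have -> : c i / w B * q B -
    (c i * (s1^-1 + s2^-1) * q B - c i / (s1 * s2) * (w B * q B)) =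
    c i * q B * ((w B)^-1 - (s1^-1 + s2^-1 - w B / (s1 * s2))) by ring.
by rewrite mulr_ge0 ?subr_ge0// mulr_ge0// ltW.
Qed.

End Weights.

Section Signature.
Context {d : measure_display} {T : measurableType d} {R : realType}.
Context (P : probability T R) {n : nat} (A : 'I_n.+1 -> set T).
Hypothesis mA : forall i, measurable (A i).
Implicit Types (B : {set 'I_n.+1}).

Definition signature (t : T) : {set 'I_n.+1} := [set i | t \in A i]%SET.

Definition atom B : set T := [set t | signature t = B].

Lemma measurable_atom B : measurable (atom B).
Proof.
have -> : atom B = \bigcap_i (if i \in B then A i else ~` A i).
  apply/seteqP; split => [t <- i _|t tB].
    by rewrite finset.inE; case: ifPn => [/set_mem//|/negP tA /mem_set].
  apply/finset.setP => i; rewrite finset.inE; have := tB i I.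
  by case: ifPn => _ tA; [exact/mem_set|apply/negP => /set_mem].
apply: fin_bigcap_measurable => [|i _]; first exact: finite_finset.
by case: ifPn => // _; exact: measurableC.
Qed.

Lemma pr_ge0 (E : set T) : 0 <= pr P E.
Proof. by rewrite fine_ge0. Qed.

(** An event determined by the signature is a finite disjoint union of atoms. *)
Lemma pr_sum_atom (E : set T) (Q : pred {set 'I_n.+1}) :
    (forall t, E t <-> Q (signature t)) ->
  pr P E = \sum_(B | Q B) pr P (atom B).
Proof.
move=> EQ; pose r := [seq B <- enum {set 'I_n.+1} | Q B].
have rE B : (B \in r) = Q B by rewrite mem_filter mem_enum andbT.
have mB B : measurable (atom B) := measurable_atom B.
have -> : E = \bigcup_(B in [set` r]) atom B.
  apply/seteqP; split => [t /EQ tQ|t [B QB /= tB]].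
    by exists (signature t) => //=; rewrite rE.
  by apply/EQ; rewrite tB -rE.
rewrite /pr measure_fin_bigcup//; last by move=> B C _ _ [t [<- <-]].
rewrite -fsbig_seq /=; last by rewrite filter_uniq// enum_uniq.
transitivity (\sum_(B <- r) fine (P (atom B))).
  by apply/esym/sum_fine => B _; exact: fin_num_measure.
by rewrite big_filter big_enum_cond; exact: eq_bigl.
Qed.

End Signature.

Lemma delta_le_atom (d : measure_display) (T : measurableType d) (R : realType)
    (P : probability T R) (n : nat) (A : 'I_n.+1 -> set T) (c : 'I_n.+1 -> R) :
    (forall i, measurable (A i)) -> (forall k, 0 < c k) ->
  delta P A c <= pr P (atom A [set: 'I_n.+1]%SET).
Proof.
move=> mA c_gt0; rewrite /delta; apply/bigmax_leP; split; first exact: pr_ge0.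
move=> i _; rewrite ge_max pr_ge0 andbT ler_pdivrMr ?minc_gt0//.
pose p B := pr P (atom A B).
have -> : alpha P A i = \sum_(B : {set 'I_n.+1} | i \in B) p B.
  apply: pr_sum_atom => // t; rewrite finset.inE.
  by split=> [/mem_set|/set_mem].
have -> : gamma P A c i =
    \sum_(B : {set 'I_n.+1} | i \in B) (\sum_(k in B) c k) * p B.
  rewrite /gamma; under [RHS]eq_bigr do rewrite mulr_suml.
  (* For fixed k, the sets B containing both i and k make up the event that [A i] and [A k] both
     occur. *)
  rewrite [RHS](exchange_big_dep xpredT)//=; apply: eq_bigr => k _.
  rewrite -mulr_sumr; congr (_ * _); apply: pr_sum_atom => // t.
  rewrite !finset.inE; split=> [[/mem_set-> /mem_set->]//|].
  by move=> /andP[/set_mem ? /set_mem ?].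
(* The full set contributes exactly [minc c] times its atom; all other terms are nonpositive by
   [proper_weight_sum_le]. *)
rewrite mulr_sumr -sumrB (bigD1 [set: 'I_n.+1]%SET) ?finset.in_setT//=.
rewrite -[leRHS]addr0 lerD//.
  rewrite -mulrBl mulrC ler_wpM2l ?pr_ge0//.
  rewrite (eq_bigl xpredT) => [|k]; last by rewrite finset.in_setT.
  by rewrite opprB addrC subrK.
apply: sumr_le0 => B /andP[_ BT]; rewrite -mulrBl.
by rewrite mulr_le0_ge0 ?pr_ge0// subr_le0 proper_weight_sum_le.
Qed.

Theorem theorem3p3 (d : measure_display) (T : measurableType d) (R : realType)
    (P : probability T R) (n : nat) (A : 'I_n.+1 -> set T) (c : 'I_n.+1 -> R)
    (finT : finite_set [set: T])
    (mA : forall i, measurable (A i))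
    (c_gt0 : forall k, 0 < c k) :
  ell_NEW_II P A c <= pr P (\bigcup_i A i).
Proof.
pose x := delta P A c.
pose q B := pr P (atom A B) - (if B == [set: 'I_n.+1]%SET then x else 0).
have q_ge0 B : 0 <= q B.
  rewrite /q; case: eqP => [->|_]; last by rewrite subr0 pr_ge0.
  by rewrite subr_ge0 delta_le_atom.
(* An event containing the full atom loses exactly x on passing from atoms to q; this covers the
   union, each [A i] and each pairwise intersection. *)
have prBx (E : set T) (Q : pred {set 'I_n.+1}) :
    (forall t, E t <-> Q (signature A t)) -> Q [set: 'I_n.+1]%SET ->
    pr P E - x = \sum_(B | Q B) q B.
  move=> EQ QT; rewrite (pr_sum_atom P A mA E Q EQ) sumrB; congr (_ - _).
  rewrite (bigD1 [set: 'I_n.+1]%SET)//= eqxx big1 ?addr0// => B /andP[_].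
  by move=> /negbTE->.
have mem_sig i t : A i t <-> i \in signature A t.
  by rewrite finset.inE; split=> [/mem_set|/set_mem].
rewrite /ell_NEW_II -/x -lerBrDl.
rewrite (prBx _ (fun B => B != finset.set0)); last 2 first.
- move=> t; split=> [[i _ Ait]|/finset.set0Pn[i]].
    by apply/finset.set0Pn; exists i; apply/mem_sig.
  by move=> /mem_sig ?; exists i.
- by apply/finset.set0Pn; exists ord0; rewrite finset.in_setT.
(* Each nonempty B splits its mass among its elements i in shares c i / w B, which add up to 1. *)
have -> : \sum_(B | B != finset.set0) q B =
    \sum_i \sum_(B : {set 'I_n.+1} | i \in B) c i / (\sum_(k in B) c k) * q B.
  rewrite [RHS](exchange_big_dep (fun B => B != finset.set0))/=; last first.
    by move=> i B _ iB; apply/finset.set0Pn; exists i.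
  apply: eq_bigr => B /finset.set0Pn[i iB].
  by rewrite -!mulr_suml divff ?mul1r// gt_eqF// (weight_sum_gt0 c c_gt0 i).
apply: ler_sum => i _; apply: ell'_le => //.
  by apply: prBx; [exact: mem_sig|rewrite finset.in_setT].
(* Same double count as for [gamma], now with q; each pairwise probability is lowered by x. *)
under [RHS]eq_bigr do rewrite mulr_suml.
rewrite [RHS](exchange_big_dep xpredT)//=; apply: eq_bigr => k _.
rewrite -mulr_sumr; congr (_ * _); apply: prBx; last by rewrite !finset.in_setT.
move=> t; split=> [[/mem_sig-> /mem_sig->]//|/andP[]].
by move=> /mem_sig ? /mem_sig ?.
Qed.
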